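(* Let $(a,b)$ be a pair of elements in a non-commutative probability space $(\mathcal{A},\varphi)$. The bi-Boolean partial $\eta$-transform $\eta_{(a,b)}$ of $(a,b)$ is given by $$\eta_{(a,b)}(z,w)=\eta_a(z)+\eta_b(w)+\frac{G_{(a,b)}(1/z,1/w)}{G_a(1/z)\,G_b(1/w)}-1$$ (as formal power series in commuting variables $z$ and $w$).
   Context: A non-commutative probability space $(\mathcal{A},\varphi)$ is a unital complex algebra with a unital linear functional $\varphi$. For $\chi:\{1,\dots,n\}\to\{\ell,r\}$ with $\chi^{-1}(\{\ell\})=\{i_1<\cdots<i_p\}$ and $\chi^{-1}(\{r\})=\{i_{p+1}>\cdots>i_n\}$, let $\prec_\chi$ be the total order $i_1\prec_\chi\cdots\prec_\chi i_n$. $\mathrm{BI}(\chi)$ is the set of partitions of $\{1,\dots,n\}$ all of whose blocks are intervals for $\prec_\chi$. For $V=\{v_1<\cdots<v_s\}$ put $(a_1,\dots,a_n)|_V=(a_{v_1},\dots,a_{v_s})$, and regard $\chi|_V$ as a map on $\{1,\dots,s\}$ via $v_i\leftrightarrow i$. The B-$(\ell,r)$-cumulants are the unique multilinear functionals $B_\chi:\mathcal{A}^n\to\mathbb{C}$ with $\varphi(a_1\cdots a_n)=\sum_{\pi\in\mathrm{BI}(\chi)}\prod_{V\in\pi}B_{\chi|_V}((a_1,\dots,a_n)|_V)$ for all $n\ge1$, $\chi$, $a_1,\dots,a_n$. For $m,n\ge0$ with $m+n\ge1$, $\chi_{m,n}:\{1,\dots,m+n\}\to\{\ell,r\}$ is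 $\ell$ on $\{1,\dots,m\}$ and $r$ on $\{m+1,\dots,m+n\}$; $B_{m,n}(a,b)=B_{\chi_{m,n}}(a,\dots,a,b,\dots,b)$ ($m$ copies of $a$, then $n$ copies of $b$); $B_m(a)=B_\chi(a,\dots,a)$ for constant $\chi:\{1,\dots,m\}\to\{\ell,r\}$ (so $B_{m,0}(a,b)=B_m(a)$, $B_{0,n}(a,b)=B_n(b)$). Formal series: $$\eta_a(z)=\sum_{m\ge1}B_m(a)z^m,\qquad G_a(z)=\frac1z+\sum_{m\ge1}\frac{\varphi(a^m)}{z^{m+1}},$$ $$\eta_{(a,b)}(z,w)=\sum_{m,n\ge0,\,m+n\ge1}B_{m,n}(a,b)z^mw^n,\qquad G_{(a,b)}(z,w)=\frac1{zw}+\sum_{m,n\ge0,\,m+n\ge1}\frac{\varphi(a^mb^n)}{z^{m+1}w^{n+1}}.$$ *)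

(* Defs.v *)
From HB Require Import structures.
From mathcomp Require Import all_boot all_order all_algebra.
From mathcomp Require Import boolp reals.
From mathcomp Require Import complex.

Set Implicit Arguments.
Unset Strict Implicit.
Unset Printing Implicit Defensive.

Import GRing.Theory.
Local Open Scope ring_scope.

(* [fps R] is R[[X]]; it is a commutative ring, and an integral domain when R
   is one, so that [fps (fps K)] is K[[z]][[w]] = K[[z, w]] and
   [{fraction fps (fps K)}] is its field of fractions. *)
Record fps (R : Type) := Fps { coefs : nat -> R }.

Lemma fpsP (R : Type) (f g : fps R) : coefs f =1 coefs g <-> f = g.
Proof. by case: f g => [f] [g]; split=> [/funext /= ->|->]. Qed.

HB.instance Definition _ (R : Type) := gen_eqMixin (fps R).
HB.instance Definition _ (R : Type) := gen_choiceMixin (fps R).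

Section FpsZmod.
Variable R : zmodType.
Implicit Types f g h : fps R.

Let zero : fps R := Fps (fun=> 0).
Let opp f : fps R := Fps (fun n => - coefs f n).
Let add f g : fps R := Fps (fun n => coefs f n + coefs g n).

Fact fps_addA : associative add.
Proof. by move=> f g h; apply/fpsP => n /=; rewrite addrA. Qed.
Fact fps_addC : commutative add.
Proof. by move=> f g; apply/fpsP => n /=; rewrite addrC. Qed.
Fact fps_add0 : left_id zero add.
Proof. by move=> f; apply/fpsP => n /=; rewrite add0r. Qed.
Fact fps_addN : left_inverse zero opp add.
Proof. by move=> f; apply/fpsP => n /=; rewrite addNr. Qed.

HB.instance Definition _ :=
  GRing.isZmodule.Build (fps R) fps_addA fps_addC fps_add0 fps_addN.

Lemma coefs0 n : coefs (0 : fps R) n = 0. Proof. by []. Qed.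
Lemma coefsN f n : coefs (- f) n = - coefs f n. Proof. by []. Qed.
Lemma coefsD f g n : coefs (f + g) n = coefs f n + coefs g n.
Proof. by []. Qed.
End FpsZmod.

Section FpsRing.
Variable R : comNzRingType.
Implicit Types f g h : fps R.

Let one : fps R := Fps (fun n => (n == 0%N)%:R).
Let mul f g : fps R :=
  Fps (fun n => \sum_(i < n.+1) coefs f i * coefs g (n - i)%N).

Let trunc n f : {poly R} := \poly_(i < n.+1) coefs f i.

Let coef_trunc n f i : (i <= n)%N -> (trunc n f)`_i = coefs f i.
Proof. by move=> lein; rewrite coef_poly ltnS lein. Qed.

Let coefs_mul n f g i : (i <= n)%N ->
  coefs (mul f g) i = (trunc n f * trunc n g)`_i.
Proof.
move=> lein; rewrite coefM; apply: eq_bigr => j _.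
have leji : (j <= i)%N by rewrite -ltnS.
by rewrite !coef_trunc ?(leq_trans _ lein) ?leq_subr.
Qed.

Fact fps_mulC : commutative mul.
Proof.
by move=> f g; apply/fpsP => n; rewrite !(@coefs_mul n) // mulrC.
Qed.

Let coef_mulE n (p q r : {poly R}) :
  (forall i, (i <= n)%N -> p`_i = q`_i) -> (p * r)`_n = (q * r)`_n.
Proof.
by move=> pq; rewrite !coefM; apply: eq_bigr => j _; rewrite pq // -ltnS.
Qed.

Fact fps_mulA : associative mul.
Proof.
have L f g h n : coefs (mul (mul f g) h) n =
    (trunc n f * trunc n g * trunc n h)`_n.
  rewrite (@coefs_mul n) //; apply: coef_mulE => i lein.
  by rewrite coef_trunc // (@coefs_mul n).
move=> f g h; apply/fpsP => n.
by rewrite L fps_mulC L mulrC mulrA.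
Qed.

Fact fps_mul1 : left_id one mul.
Proof.
move=> f; apply/fpsP => n /=; rewrite big_ord_recl /= mul1r subn0.
by rewrite big1 ?addr0 // => i _; rewrite mul0r.
Qed.

Fact fps_mulDl : left_distributive mul +%R.
Proof.
move=> f g h; apply/fpsP => n /=; rewrite -big_split.
by apply: eq_bigr => i _; rewrite mulrDl.
Qed.

Fact fps_one_neq0 : one != 0.
Proof.
by apply/eqP => /fpsP /(_ 0%N) /= /eqP; rewrite (negbTE (oner_neq0 R)).
Qed.

HB.instance Definition _ := GRing.Zmodule_isComNzRing.Build (fps R)
  fps_mulA fps_mulC fps_mul1 fps_mulDl fps_one_neq0.

Lemma coefs1 n : coefs (1 : fps R) n = (n == 0%N)%:R. Proof. by []. Qed.
Lemma coefsM f g n :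
  coefs (f * g) n = \sum_(i < n.+1) coefs f i * coefs g (n - i)%N.
Proof. by []. Qed.

Let unit : {pred fps R} := fun f => `[< exists g, g * f = 1 >].
Let inv f : fps R :=
  if pselect (exists g, g * f = 1) is left e then sval (cid e) else f.

Fact fps_mulVx : {in unit, left_inverse 1 inv *%R}.
Proof.
move=> f /asboolP fu; rewrite /inv; case: pselect => // e.
by case: cid.
Qed.
Fact fps_unitPl f g : g * f = 1 -> unit f.
Proof. by move=> gf; apply/asboolP; exists g. Qed.
Fact fps_invr_out : {in [predC unit], inv =1 id}.
Proof.
move=> f; rewrite inE => /negP fu; rewrite /inv; case: pselect => // e.
by case: fu; apply/asboolP.
Qed.

HB.instance Definition _ := GRing.ComNzRing_hasMulInverse.Build (fps R)
  fps_mulVx fps_unitPl fps_invr_out.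
End FpsRing.

Section FpsIdomain.
Variable R : idomainType.

Let fps_valuation (f : fps R) : f != 0 ->
  exists n, coefs f n != 0 /\ forall i, (i < n)%N -> coefs f i = 0.
Proof.
move=> f0; have ex : exists n, coefs f n != 0.
  apply: contrapT => nex; move/eqP: f0; apply; apply/fpsP => n.
  by apply/eqP; apply: contrapT => /negP fn; apply: nex; exists n.
case: (ex_minnP ex) => n fn min; exists n; split=> // i lin.
by apply/eqP; apply: contraLR lin => /min; rewrite -leqNgt.
Qed.

Fact fps_mulf_eq0 : GRing.integral_domain_axiom (fps R).
Proof.
move=> f g fg; apply/orP.
case: (eqVneq f 0) => [|/fps_valuation [m [fm ltm]]]; first by left.
case: (eqVneq g 0) => [|/fps_valuation [n [gn ltn]]]; first by right.
have /fpsP /(_ (m + n)%N) := fg; rewrite coefsM coefs0.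
have lt : (m < (m + n).+1)%N by rewrite ltnS leq_addr.
rewrite (bigD1 (Ordinal lt)) //= big1 => [|i].
  by rewrite addKn addr0 => /eqP; rewrite mulf_eq0 (negbTE fm) (negbTE gn).
rewrite -val_eqE /= neq_ltn => /orP [lim|ltmi]; first by rewrite ltm ?mul0r.
rewrite ltn ?mulr0 // ltn_subLR ?ltn_add2r //.
by rewrite -ltnS ltn_ord.
Qed.

HB.instance Definition _ :=
  GRing.ComUnitRing_isIntegral.Build (fps R) fps_mulf_eq0.
End FpsIdomain.

Notation "x %:F" := (FracField.tofrac x) : ring_scope.

(* The series \sum_(m, n) c m n * z ^ m * w ^ n, as an element of K[[z]][[w]] *)
Definition fps2 (K : Type) (c : nat -> nat -> K) : fps (fps K) :=
  Fps (fun n => Fps (fun m => c m n)).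

(* f(z) and f(w) as elements of K[[z, w]] *)
Definition in_z (K : zmodType) (f : fps K) : fps (fps K) :=
  fps2 (fun m n => if n == 0%N then coefs f m else 0).
Definition in_w (K : zmodType) (f : fps K) : fps (fps K) :=
  fps2 (fun m n => if m == 0%N then coefs f n else 0).

Variant side := Lft | Rgt.

Definition chi_prec n (chi : {ffun 'I_n -> side}) (i j : 'I_n) : bool :=
  match chi i, chi j with
  | Lft, Lft => (i < j)%N
  | Lft, Rgt => true
  | Rgt, Lft => false
  | Rgt, Rgt => (j < i)%N
  end.

Definition chi_interval n (chi : {ffun 'I_n -> side}) (V : {set 'I_n}) : bool :=
  [forall i in V, forall k in V, forall j,
     chi_prec chi i j && chi_prec chi j k ==> (j \in V)].

Definition BI n (chi : {ffun 'I_n -> side}) : {set {set {set 'I_n}}} :=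
  [set P | partition P [set: 'I_n] & [forall V in P, chi_interval chi V]].

(* [enum_val] lists the elements of V in increasing order. *)
Definition restr (T : Type) n (f : {ffun 'I_n -> T}) (V : {set 'I_n}) :
    {ffun 'I_#|V| -> T} := [ffun i => f (enum_val i)].

Section Cumulants.
Variables (K : fieldType) (A : algType K).

Definition upd n (a : {ffun 'I_n -> A}) (i : 'I_n) (x : A) : {ffun 'I_n -> A} :=
  [ffun j => if j == i then x else a j].

Definition multilinear n (f : {ffun 'I_n -> A} -> K) : Prop :=
  forall a i (c : K) (x y : A),
    f (upd a i (c *: x + y)) = c * f (upd a i x) + f (upd a i y).

Definition multi_functional :=
  forall n, {ffun 'I_n -> side} -> {ffun 'I_n -> A} -> K.

Definition block_prod (B : multi_functional) n (chi : {ffun 'I_n -> side})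
    (a : {ffun 'I_n -> A}) (P : {set {set 'I_n}}) : K :=
  \prod_(V in P) B #|V| (restr chi V) (restr a V).

(* Only the values at n >= 1 are constrained. *)
Definition is_Bcumulants (phi : {scalar A}) (B : multi_functional) : Prop :=
  (forall n (chi : {ffun 'I_n -> side}), (0 < n)%N -> multilinear (B n chi)) /\
  (forall n (chi : {ffun 'I_n -> side}) (a : {ffun 'I_n -> A}), (0 < n)%N ->
     phi (\prod_(i < n) a i) = \sum_(P in BI chi) block_prod B chi a P).

Definition Bcum2 (B : multi_functional) (m n : nat) (a b : A) : K :=
  B (m + n)%N [ffun i : 'I_(m + n) => if (i < m)%N then Lft else Rgt]
              [ffun i : 'I_(m + n) => if (i < m)%N then a else b].

(* B_m(a); by [Bcumulants_const] below the choice of side is immaterial. *)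
Definition Bcum1 (B : multi_functional) (m : nat) (a : A) : K :=
  B m [ffun=> Lft] [ffun=> a].

Definition eta1 (B : multi_functional) (a : A) : fps K :=
  Fps (fun m => if m == 0%N then 0 else Bcum1 B m a).

Definition eta2 (B : multi_functional) (a b : A) : fps (fps K) :=
  fps2 (fun m n => if (m + n == 0)%N then 0 else Bcum2 B m n a b).

(* G_a is a series in 1/z and G_(a,b) a series in 1/z and 1/w; hence G_a(1/z)
   and G_(a,b)(1/z, 1/w) are power series.  The terms 1/z and 1/(zw) of G_a and
   G_(a,b) are the cases m = 0 and m = n = 0 below, since phi 1 = 1. *)
Definition cauchyV (phi : {scalar A}) (a : A) : fps K :=
  Fps (fun k => if k is m.+1 then phi (a ^+ m) else 0).

Definition cauchy2V (phi : {scalar A}) (a b : A) : fps (fps K) :=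
  fps2 (fun k l => match k, l with
                   | m.+1, n.+1 => phi (a ^+ m * b ^+ n)
                   | _, _ => 0
                   end).

Lemma BI_setT n (chi : {ffun 'I_n -> side}) : (0 < n)%N -> [set setT] \in BI chi.
Proof.
move=> n0; rewrite inE; apply/andP; split.
  apply/and3P; split; first by rewrite /cover big_set1.
    by apply/trivIsetP => V W /set1P -> /set1P ->; rewrite eqxx.
  by rewrite inE eq_sym -cards_eq0 cardsT card_ord -lt0n.
by apply/forall_inP => V /set1P ->; do 2!apply/forall_inP => ? _;
  apply/forallP => j; rewrite inE implybT.
Qed.

Lemma BI_card_gt0 n (chi : {ffun 'I_n -> side}) P V :
  P \in BI chi -> V \in P -> (0 < #|V|)%N.
Proof.
rewrite inE => /andP [/and3P [_ _ P0] _] VP; rewrite lt0n cards_eq0.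
by apply: contraNneq P0 => <-.
Qed.

Lemma BI_card_lt n (chi : {ffun 'I_n -> side}) P V :
  P \in BI chi -> P != [set setT] -> V \in P -> (#|V| < n)%N.
Proof.
move=> PBI PT VP; have := max_card (mem V); rewrite card_ord ltn_neqAle => ->.
rewrite andbT.
apply: contraNneq PT => cV.
have VT : V = setT.
  by apply/eqP; rewrite eqEcard subsetT cardsT card_ord cV leqnn.
apply/eqP/setP => W; rewrite inE; apply/idP/eqP => [WP|->]; last by rewrite -VT.
have := PBI; rewrite inE => /andP [/and3P [_ /trivIsetP tP _] _].
apply/eqP; apply: contraT => WT; rewrite -VT in WT.
have := tP _ _ WP VP WT; rewrite VT -setI_eq0 setIT -cards_eq0.
by rewrite eqn0Ngt (BI_card_gt0 PBI WP).
Qed.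

Lemma restr_setT (F : multi_functional) n (chi : {ffun 'I_n -> side}) a :
  F #|[set: 'I_n]| (restr chi setT) (restr a setT) = F n chi a.
Proof.
have eN : #|[set: 'I_n]| = n by rewrite cardsT card_ord.
have val_enum (i : 'I_#|[set: 'I_n]|) : enum_val i = i :> nat.
  have lt_in : (i < n)%N by rewrite -[n in (_ < n)%N]eN.
  by rewrite /enum_val enum_setT -enumT nth_enum_ord.
suff H m (e : m = n) (chi' : {ffun 'I_m -> side}) (a' : {ffun 'I_m -> A}) :
    (forall i j, val i = val j -> chi' i = chi j /\ a' i = a j) ->
    F m chi' a' = F n chi a.
  apply: H => // i j ij; rewrite !ffunE.
  by suff -> : enum_val i = j by []; apply: val_inj; rewrite /= val_enum.
case: _ / e chi a {eN val_enum} => chi a H.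
by congr (F _ _ _); apply/ffunP => i; have [] := H i i erefl.
Qed.

Lemma block_prod_setT (B : multi_functional) n (chi : {ffun 'I_n -> side}) a :
  block_prod B chi a [set setT] = B n chi a.
Proof. by rewrite /block_prod big_set1 restr_setT. Qed.

Lemma sum_BI (B : multi_functional) n (chi : {ffun 'I_n -> side}) a :
  (0 < n)%N ->
  \sum_(P in BI chi) block_prod B chi a P =
    B n chi a + \sum_(P in BI chi | P != [set setT]) block_prod B chi a P.
Proof. by move=> n0; rewrite (bigD1 _ (BI_setT chi n0)) /= block_prod_setT. Qed.

Lemma Bcumulants_uniq (phi : {scalar A}) (B B' : multi_functional) :
  is_Bcumulants phi B -> is_Bcumulants phi B' ->
  forall n (chi : {ffun 'I_n -> side}) a, (0 < n)%N -> B n chi a = B' n chi a.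
Proof.
move=> [_ BE] [_ B'E] n; elim/ltn_ind: n => n IHn chi a n0.
have := BE n chi a n0; rewrite (B'E n chi a n0) !sum_BI // => /esym.
rewrite (eq_bigr (fun P => block_prod B' chi a P)); first exact: addIr.
move=> P /andP [PBI PT]; apply: eq_bigr => V VP.
by rewrite IHn ?(BI_card_lt PBI) ?(BI_card_gt0 PBI).
Qed.

Fixpoint Bfuel (phi : {scalar A}) (d : nat) : multi_functional :=
  fun n chi a =>
    if d is d'.+1 then
      phi (\prod_(i < n) a i) -
        \sum_(P in BI chi | P != [set setT]) block_prod (Bfuel phi d') chi a P
    else 0.

Lemma Bfuel_stable phi d d' n (chi : {ffun 'I_n -> side}) a :
  (0 < n)%N -> (n <= d)%N -> (n <= d')%N -> Bfuel phi d chi a = Bfuel phi d' chi a.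
Proof.
elim: d d' n chi a => [|d IHd] [|d'] n chi a n0 nd nd' //=.
- by rewrite leqNgt n0 in nd.
- by rewrite leqNgt n0 in nd'.
congr (_ - _); apply: eq_bigr => P /andP [PBI PT]; apply: eq_bigr => V VP.
have ltV := BI_card_lt PBI PT VP.
by apply: IHd; rewrite ?(BI_card_gt0 PBI) // -ltnS (leq_trans ltV).
Qed.

Lemma prod_upd n (a : {ffun 'I_n -> A}) i :
  exists L R, forall x, \prod_(j < n) upd a i x j = L * x * R.
Proof.
rewrite -[index_enum _]/(index_enum 'I_n).
have := index_enum_uniq 'I_n; have := mem_index_enum i.
case/splitPr => p1 p2; rewrite cat_uniq /= negb_or => /and3P [_].
case/andP => ip1 _ /andP [ip2 _].
exists (\prod_(j <- p1) a j), (\prod_(j <- p2) a j) => x.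
rewrite big_cat big_cons /= ffunE eqxx mulrA; congr (_ * _ * _);
  rewrite !big_seq; apply: eq_bigr => j jp; rewrite ffunE;
  by case: eqP => // ji; rewrite ji ?(negbTE ip1) ?(negbTE ip2) in jp.
Qed.

Lemma restr_upd_out n (a : {ffun 'I_n -> A}) i x (V : {set 'I_n}) :
  i \notin V -> restr (upd a i x) V = restr a V.
Proof.
move=> iV; apply/ffunP => j; rewrite !ffunE; case: eqP => // ji.
by move: iV; rewrite -ji enum_valP.
Qed.

Lemma restr_upd_in n (a : {ffun 'I_n -> A}) i x (V : {set 'I_n})
    (iV : i \in V) :
  restr (upd a i x) V = upd (restr a V) (enum_rank_in iV i) x.
Proof.
apply/ffunP => j; rewrite !ffunE; congr (if _ then _ else _).
apply/eqP/eqP => [ji|->]; last by rewrite enum_rankK_in.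
by apply: enum_val_inj; rewrite enum_rankK_in.
Qed.

Lemma multilinear_block_prod (B : multi_functional) n
    (chi : {ffun 'I_n -> side}) P :
  (forall m (chi' : {ffun 'I_m -> side}), multilinear (B m chi')) ->
  P \in BI chi -> multilinear (fun a => block_prod B chi a P).
Proof.
move=> Blin; rewrite inE => /andP [/and3P [/eqP cP /trivIsetP tP _] _].
move=> a i c x y.
have : i \in cover P by rewrite cP inE.
rewrite /cover => /bigcupP [V VP iV].
have E z : block_prod B chi (upd a i z) P =
    B _ (restr chi V) (upd (restr a V) (enum_rank_in iV i) z) *
    \prod_(W in P | W != V) B _ (restr chi W) (restr a W).
  rewrite /block_prod (bigD1 V) //= restr_upd_in; congr (_ * _).
  apply: eq_bigr => W /andP [WP WV]; rewrite restr_upd_out //.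
  apply: contraTN iV => iW; have := tP _ _ WP VP WV.
  by rewrite disjoint_subset => /subsetP /(_ _ iW).
by rewrite !E Blin mulrDl mulrA.
Qed.

Lemma multilinear_Bfuel phi d n (chi : {ffun 'I_n -> side}) :
  multilinear (Bfuel phi d chi).
Proof.
elim: d n chi => [|d IHd] n chi a i c x y /=; first by rewrite mulr0 addr0.
have [L [R E]] := prod_upd a i; rewrite !E mulrDr mulrDl.
rewrite -scalerAr -scalerAl linearP /=.
rewrite (eq_bigr (fun P => c * block_prod (Bfuel phi d) chi (upd a i x) P +
                           block_prod (Bfuel phi d) chi (upd a i y) P)).
  by rewrite big_split /= -mulr_sumr opprD mulrBr addrACA.
by move=> P /andP [PBI _]; rewrite (multilinear_block_prod IHd PBI).
Qed.

Lemma Bcumulants_exist (phi : {scalar A}) : exists B, is_Bcumulants phi B.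
Proof.
exists (fun n chi a => Bfuel phi n chi a); split.
  by move=> n chi _; exact: multilinear_Bfuel.
move=> [//|n] chi a n0; rewrite sum_BI //=.
rewrite [X in _ - X](eq_bigr (fun P =>
  block_prod (fun n chi a => Bfuel phi n chi a) chi a P)) ?subrK //.
move=> P /andP [PBI PT]; apply: eq_bigr => V VP.
by apply: Bfuel_stable; rewrite ?(BI_card_gt0 PBI) // -ltnS (BI_card_lt PBI PT).
Qed.

(* Exchanging l and r reverses the order, hence keeps the intervals. *)
Definition flip_side (s : side) : side := if s is Lft then Rgt else Lft.
Definition flip n (chi : {ffun 'I_n -> side}) : {ffun 'I_n -> side} :=
  [ffun i => flip_side (chi i)].

Lemma BI_flip n (chi : {ffun 'I_n -> side}) : BI (flip chi) = BI chi.
Proof.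
have prec_flip i j : chi_prec (flip chi) i j = chi_prec chi j i.
  by rewrite /chi_prec !ffunE; case: (chi i); case: (chi j).
apply/setP => P; rewrite !inE; congr (_ && _); apply: eq_forallb_in => V _.
by apply/forall_inP/forall_inP => H i iV; apply/forall_inP => k kV;
  apply/forallP => j; have /forall_inP /(_ _ iV) /forallP /(_ j) := H _ kV;
  rewrite ?prec_flip andbC.
Qed.

Lemma Bcumulants_flip (phi : {scalar A}) (B : multi_functional) :
  is_Bcumulants phi B ->
  forall n (chi : {ffun 'I_n -> side}) a, (0 < n)%N -> B n (flip chi) a = B n chi a.
Proof.
move=> BB; apply: (Bcumulants_uniq (B := fun n chi a => B n (flip chi) a) _ BB).
have [Blin BE] := BB; split=> [n chi n0|n chi a n0]; first exact: Blin.
rewrite (BE n (flip chi) a n0) BI_flip; apply: eq_bigr => P _.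
apply: eq_bigr => V _; congr (B _ _ _).
by apply/ffunP => i; rewrite !ffunE.
Qed.

Lemma Bcumulants_const (phi : {scalar A}) (B : multi_functional) :
  is_Bcumulants phi B ->
  forall n (s : side) a, (0 < n)%N -> B n [ffun=> s] [ffun=> a] = Bcum1 B n a.
Proof.
move=> BB n [] a n0 //; rewrite /Bcum1 -(Bcumulants_flip BB) //.
by congr (B _ _ _); apply/ffunP => i; rewrite !ffunE.
Qed.

End Cumulants.

(* Main.v *)
(* Listed along the order of chi_{m,n}, the word a^m b^n reads a...ab...b, and
   BI(chi_{m,n}) consists of the partitions of this list into consecutive
   blocks.  Splitting off the first block gives, with h_a = sum phi(a^m) z^m,
   h_b = sum phi(b^n) w^n and H = sum phi(a^m b^n) z^m w^n,
     h_a = 1 + eta_a h_a   and   H = eta_a H + D h_b,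
   where D = 1 + eta_(a,b) - eta_a - eta_b keeps, besides 1, the blocks
   containing both a and b.  Hence H = h_a h_b D, and G_a(1/z) = z h_a,
   G_b(1/w) = w h_b, G_(a,b)(1/z, 1/w) = z w H. *)
Require Import Defs.
From mathcomp Require Import all_boot all_order all_algebra.
From mathcomp Require Import reals.
From mathcomp Require Import complex.
From mathcomp Require Import zify ring.

Set Implicit Arguments.
Unset Strict Implicit.
Unset Printing Implicit Defensive.

Import Order.TTheory GRing.Theory.
Local Open Scope ring_scope.

(** * Sums over interval partitions, by their first block *)

Section IntervalPartitions.
Variables (K : comNzRingType) (T : finType) (n : nat) (rk : T -> 'I_n).
Variable w : {set T} -> K.
Hypothesis rk_bij : bijective rk.

Definition is_interval (V : {set T}) : bool :=
  [forall i in V, forall k in V, forall j,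
     (rk i < rk j)%N && (rk j < rk k)%N ==> (j \in V)].

Definition rk_seg (i j : nat) : {set T} := [set x | (i <= rk x < j)%N].

Definition rk_tail (i : nat) : {set T} := [set x | (i <= rk x)%N].

Definition interval_partitions (A : {set T}) : {set {set {set T}}} :=
  [set P | partition P A & [forall V in P, is_interval V]].

(** With cumulant weights for [w] this becomes a moment; an arbitrary [w] lets sums over different
    ground sets be compared. *)
Definition tail_sum (i : nat) : K :=
  \sum_(P in interval_partitions (rk_tail i)) \prod_(V in P) w V.

Lemma tail_sum_end : tail_sum n = 1.
Proof.
have tail0 : rk_tail n = set0.
  by apply/setP => x; rewrite !inE leqNgt ltn_ord.
rewrite /tail_sum tail0 (bigD1 set0) /=; last first.
  rewrite inE partition_set0 eqxx /=.
  by apply/forall_inP => V; rewrite inE.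
rewrite big_set0 big1 ?addr0 // => P; rewrite inE partition_set0.
by case/andP => /andP [/eqP -> _]; rewrite eqxx.
Qed.

Lemma is_interval_seg i j : is_interval (rk_seg i j).
Proof.
apply/forall_inP => x; rewrite inE => /andP [ix _].
apply/forall_inP => y; rewrite inE => /andP [_ yj].
apply/forallP => z; apply/implyP => /andP [xz zy]; rewrite inE.
by rewrite (leq_trans ix (ltnW xz)) (ltn_trans zy yj).
Qed.

(** The interval condition is strict, so it yields only the ranks strictly between those of [x] and
    [y]; the two end ranks follow from injectivity of [rk]. *)
Lemma interval_segE (V : {set T}) x y : is_interval V -> x \in V -> y \in V ->
  (forall z, z \in V -> (rk x <= rk z <= rk y)%N) ->
  V = rk_seg (rk x) (rk y).+1.
Proof.
move=> /forall_inP Vi xV yV xVy; apply/setP => z; rewrite inE ltnS.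
apply/idP/idP => [/xVy //|/andP [xz zy]].
have rkI : injective rk by case: rk_bij => g gK _; apply: can_inj gK.
have [/val_inj /rkI <- //|neqx] := eqVneq (val (rk x)) (val (rk z)).
have [/val_inj /rkI -> //|neqy] := eqVneq (val (rk z)) (val (rk y)).
have /forall_inP /(_ _ yV) /forallP /(_ z) /implyP := Vi _ xV; apply.
by rewrite !ltn_neqAle xz zy neqx neqy.
Qed.

(* Split off the block [i, j] containing the element of rank i. *)
Lemma tail_sum_rec (i : nat) : (i < n)%N ->
  tail_sum i = \sum_(i <= j < n) w (rk_seg i j.+1) * tail_sum j.+1.
Proof.
move=> ltin; have [g rkK gK] := rk_bij.
pose x := g (Ordinal ltin).
have rkx : rk x = i :> nat by rewrite /x gK.
(* The sum is split according to the last rank in the block of [x]; [topE] identifies that block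
   with the segment from i to this rank. *)
pose top (P : {set {set T}}) := rk [arg max_(y > x in pblock P x) rk y]%N.
have topE (P : {set {set T}}) : P \in interval_partitions (rk_tail i) ->
    rk_seg i (top P).+1 \in P /\ (i <= top P)%N.
  rewrite inE => /andP [Ppart /forall_inP Pint].
  have xP : x \in cover P by rewrite (cover_partition Ppart) inE rkx.
  have xB : x \in pblock P x by rewrite mem_pblock.
  have BP := pblock_mem xP; have BT := partitionS Ppart BP.
  rewrite /top; case: arg_maxnP => // y yB ymax.
  split; last by have := subsetP BT _ yB; rewrite inE.
  rewrite -{1}rkx -(interval_segE (Pint _ BP)) // => z zB.
  rewrite rkx (ymax z zB : (rk z <= rk y)%N) andbT.
  by have := subsetP BT _ zB; rewrite inE.
have top_seg (P : {set {set T}}) (j : 'I_n) : (i <= j)%N ->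
    P \in interval_partitions (rk_tail i) -> rk_seg i j.+1 \in P -> top P = j.
  move=> ij PIP sP; have [tP it] := topE P PIP.
  move: PIP; rewrite inE => /andP [/partition_trivIset triP _].
  have sE : rk_seg i (top P).+1 = rk_seg i j.+1.
    by rewrite -(def_pblock triP tP (x := x)) ?(def_pblock triP sP (x := x)) //
               inE rkx leqnn ltnS.
  apply/val_inj/eqP; rewrite eqn_leq.
  have /setP /(_ (g j)) := sE; rewrite !inE gK ij ltnSn ltnS /= => ->.
  have /setP /(_ (g (top P))) := sE; rewrite !inE gK it ltnSn ltnS /=.
  by move=> <-.
rewrite (big_nat_widenl _ 0) // big_mkord /tail_sum.
rewrite (partition_big top (fun j : 'I_n => (i <= j)%N)) /=;
  last by move=> P /topE [].
apply: eq_bigr => j ij.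
set s := rk_seg i j.+1.
have sx : x \in s by rewrite inE rkx leqnn ltnS.
have tailD : rk_tail i :\: s = rk_tail j.+1.
  apply/setP => z; rewrite !inE negb_and -!ltnNge !ltnS.
  have [jz|] := ltnP j (rk z); first by rewrite (leq_trans ij (ltnW jz)) orbT.
  by rewrite orbF; case: ltngtP.
have tailU : s :|: rk_tail j.+1 = rk_tail i.
  rewrite -tailD setDE setUIr setUCr setIT; apply/setUidPr.
  by apply/subsetP => z; rewrite !inE => /andP [].
have s_tail : [disjoint s & rk_tail j.+1].
  by rewrite -tailD disjoint_sym; rewrite disjoints_subset setDE subsetIr.
have s_notin (Q : {set {set T}}) : Q \in interval_partitions (rk_tail j.+1) ->
    s \notin Q.
  rewrite inE => /andP [Qpart _]; apply/negP => /(partitionS Qpart) /subsetP.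
  by move/(_ x sx); rewrite inE rkx ltnNge ij.
(* Removing the first block [s] and adding it back are inverse to each other, and leave the interval
   partitions of the remaining tail. *)
rewrite (reindex_onto (fun Q => s |: Q) (fun P => P :\ s)) /=; last first.
  by move=> P /andP [PIP /eqP tP]; rewrite setD1K //; have [] := topE P PIP; rewrite tP.
rewrite mulr_sumr; apply: eq_big => [Q|Q /andP [/andP [QIP /eqP tQ] /eqP QE]].
  apply/andP/idP => [[/andP [QIP /eqP tQ] /eqP QE]|QIP].
    have sQ : s \in s |: Q by rewrite setU11.
    move: QIP; rewrite !inE => /andP [Qpart /forall_inP Qint].
    rewrite -QE -tailD partitionD1 //=; apply/forall_inP => V.
    by rewrite inE => /andP [_] /Qint.
  have sU : s |: Q \in interval_partitions (rk_tail i).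
    move: QIP; rewrite !inE => /andP [Qpart /forall_inP Qint].
    rewrite -tailU partitionU1 //=; last by apply/set0Pn; exists x.
    by apply/forall_inP => V; rewrite !inE => /orP [/eqP ->|/Qint //];
      exact: is_interval_seg.
  by rewrite sU (top_seg _ j) ?setU11 // eqxx setU1K ?eqxx ?s_notin.
rewrite big_setU1 //=; have := QE => /setP /(_ s); rewrite in_setD1 eqxx /=.
by move=> <-.
Qed.

End IntervalPartitions.

(** * Comparison of tails counted from the end *)

Section TailSums.
Variables (K : comNzRingType) (T : finType) (n : nat) (rk : T -> 'I_n).
Hypothesis rk_bij : bijective rk.

Lemma card_rk_seg i j : (j <= n)%N -> #|rk_seg rk i j| = (j - i)%N.
Proof.
move=> jn; have -> : rk_seg rk i j = rk @^-1: [set k : 'I_n | (i <= k < j)%N].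
  by apply/setP => x; rewrite !inE.
rewrite on_card_preimset; last exact: onW_bij.
rewrite -sum1_card -[RHS]muln1 -sum_nat_const_nat.
rewrite (big_nat_widenl _ 0) // (big_nat_widen _ _ n) // big_mkord.
by apply: eq_bigl => k; rewrite inE andbC.
Qed.

(** Here q counts the elements after the first block, whose last rank is therefore n - q - 1. *)
Lemma tail_sum_rev (w : {set T} -> K) l : (0 < l <= n)%N ->
  tail_sum rk w (n - l) =
    \sum_(q < l) w (rk_seg rk (n - l) (n - q)) * tail_sum rk w (n - q).
Proof.
case/andP=> l0 ln; rewrite tail_sum_rec ?ltn_subrL ?l0 ?(leq_trans l0) //.
rewrite big_nat_rev -{1}(add0n (n - l)%N) big_addn subKn // big_mkord.
apply: eq_bigr => q _.
by rewrite (_ : (_ - _).+1 = n - q)%N //; have := ltn_ord q; lia.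
Qed.
End TailSums.

(* Ranks are counted from the end, so that systems of different sizes match. *)
Lemma tail_sum_eq (K : comNzRingType) (T T' : finType) (n n' c : nat)
    (rk : T -> 'I_n) (rk' : T' -> 'I_n') w w' :
  bijective rk -> bijective rk' -> (c <= n)%N -> (c <= n')%N ->
  (forall p q, (q < p <= c)%N ->
     w (rk_seg rk (n - p) (n - q)) = w' (rk_seg rk' (n' - p) (n' - q)) :> K) ->
  forall l, (l <= c)%N -> tail_sum rk w (n - l) = tail_sum rk' w' (n' - l).
Proof.
move=> rkB rkB' cn cn' ww'; elim/ltn_ind => l IHl lc.
have [->|l0] := posnP l; first by rewrite !subn0 !tail_sum_end.
rewrite !tail_sum_rev ?l0 ?(leq_trans lc) //; apply: eq_bigr => q _.
by rewrite ww' ?ltn_ord // IHl // (leq_trans _ lc) // ltnW.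
Qed.

(** [enum V] is increasing, so its entries below m form an initial run. This locates where a block
    passes from a to b. *)
Lemma enum_val_lt n (V : {set 'I_n}) (k : 'I_#|V|) (m : nat) :
  (enum_val k < m)%N = (k < #|[set x in V | (x < m)%N]|)%N.
Proof.
pose s := [seq val x | x <- enum V].
have s_sorted : sorted leq s.
  rewrite /s sorted_map /enum_mem -enumT.
  apply: sorted_filter; first by move=> x y z; apply: leq_trans.
  rewrite -sorted_map val_enum_ord; exact: iota_sorted.
have sk : nth 0%N s k = enum_val k.
  by rewrite (nth_map (enum_val k)) -?cardE // -enum_val_nth.
have cs : count (fun i => i < m)%N s = #|[set x in V | (x < m)%N]|.
  rewrite count_map -sum1_count big_enum_cond -sum1_card.
  by apply: eq_bigl => x; rewrite inE.
rewrite -sk -cs; case: (ltnP k) => [/nth_count_lt|cm]; first exact.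
apply/negbTE; rewrite -leqNgt; apply: (nth_count_ge 0%N s_sorted).
by rewrite cm size_map -cardE ltn_ord.
Qed.

Lemma BI_interval_partitions n (chi : {ffun 'I_n -> side}) (rk : 'I_n -> 'I_n) :
  (forall i j, chi_prec chi i j = (rk i < rk j)%N) ->
  BI chi = interval_partitions rk (rk_tail rk 0).
Proof.
move=> prec_rk; have -> : rk_tail rk 0 = setT by apply/setP => x; rewrite !inE.
apply/setP => P; rewrite !inE; congr (_ && _); apply: eq_forallb_in => V _.
apply: eq_forallb_in => i _; apply: eq_forallb_in => k _.
by apply: eq_forallb => j; rewrite !prec_rk.
Qed.

(** * Recursions for the moments of a^m b^n *)

Section MomentRecursion.
Variables (K : fieldType) (A : algType K) (phi : {scalar A}).
Variable B : multi_functional A.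
Hypotheses (phi1 : phi 1 = 1) (hB : is_Bcumulants phi B).

(** Lengths such as a cardinal and a sum are only propositionally equal, so entries are matched by
    position. *)
Lemma multi_functional_ext (F : multi_functional A) m n
    (chi : {ffun 'I_m -> side}) (x : {ffun 'I_m -> A})
    (chi' : {ffun 'I_n -> side}) (x' : {ffun 'I_n -> A}) : m = n ->
  (forall i j, val i = val j -> chi i = chi' j /\ x i = x' j) ->
  F m chi x = F n chi' x'.
Proof.
move=> mn; case: _ / mn chi' x' => chi' x' H.
by congr (F _ _ _); apply/ffunP => i; have [] := H i i erefl.
Qed.

Definition block_weight n (chi : {ffun 'I_n -> side}) (x : {ffun 'I_n -> A})
    (V : {set 'I_n}) : K := B (restr chi V) (restr x V).

Lemma phi_prod_tail_sum n (chi : {ffun 'I_n -> side}) (x : {ffun 'I_n -> A})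
    (rk : 'I_n -> 'I_n) :
  (forall i j, chi_prec chi i j = (rk i < rk j)%N) ->
  phi (\prod_(i < n) x i) = tail_sum rk (block_weight chi x) 0.
Proof.
case: n => [|n] in chi x rk * => prec_rk.
  (* The moment formula is assumed only for positive length; the empty word is settled by [phi1]. *)
  by rewrite big_ord0 tail_sum_end.
have [_ hphi] := hB; rewrite (hphi _ chi) //.
by rewrite /tail_sum -(BI_interval_partitions prec_rk).
Qed.

Lemma block_weight_const n (chi : {ffun 'I_n -> side}) (x : {ffun 'I_n -> A})
    (V : {set 'I_n}) s c : (0 < #|V|)%N ->
  {in V, forall i, chi i = s /\ x i = c} ->
  block_weight chi x V = Bcum1 B #|V| c.
Proof.
move=> V0 Vc; rewrite -(Bcumulants_const hB s) // /block_weight.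
by congr (B _ _); apply/ffunP => i; rewrite !ffunE; have [] := Vc _ (enum_valP i).
Qed.

Definition pair_chi m n : {ffun 'I_(m + n) -> side} :=
  [ffun i : 'I_(m + n) => if (i < m)%N then Lft else Rgt].

Definition pair_args (a b : A) m n : {ffun 'I_(m + n) -> A} :=
  [ffun i : 'I_(m + n) => if (i < m)%N then a else b].

(* For chi_{m,n} the right positions m, ..., m + n - 1 come last, reversed. *)
Definition pair_rk m n (i : 'I_(m + n)) : 'I_(m + n) :=
  if (i < m)%N then i else insubd i (m + (m + n - i.+1))%N.

(** [insubd] never falls back to its default: m <= i < m + n gives m + (m + n - i.+1) < m + n. *)
Lemma pair_rkE m n (i : 'I_(m + n)) :
  pair_rk i = (if i < m then i : nat else m + (m + n - i.+1))%N :> nat.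
Proof.
rewrite /pair_rk; case: ltnP => // mi; rewrite val_insubd.
by have := ltn_ord i; case: ifP => //; lia.
Qed.

Lemma pair_rk_bij m n : bijective (@pair_rk m n).
Proof.
apply: injF_bij => i j /(congr1 val); rewrite /= !pair_rkE => ij; apply: val_inj => /=.
by move: ij (ltn_ord i) (ltn_ord j); case: (ltnP i m); case: (ltnP j m); lia.
Qed.

Lemma pair_chi_prec m n (i j : 'I_(m + n)) :
  chi_prec (pair_chi m n) i j = (pair_rk i < pair_rk j)%N.
Proof.
rewrite /chi_prec !ffunE !pair_rkE.
by move: (ltn_ord i) (ltn_ord j); case: (ltnP i m); case: (ltnP j m); lia.
Qed.

Lemma phi_pair (a b : A) m n : phi (a ^+ m * b ^+ n) =
  tail_sum (@pair_rk m n) (block_weight (pair_chi m n) (pair_args a b m n)) 0.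
Proof.
rewrite -(phi_prod_tail_sum _ (@pair_chi_prec m n)); congr (phi _).
rewrite big_split_ord /= -[in LHS](card_ord m) -[in LHS](card_ord n) -!prodr_const.
congr (_ * _); apply: eq_bigr => i _; rewrite ffunE /=.
  by rewrite ltn_ord.
by rewrite ltnNge leq_addr.
Qed.

Lemma pair_weight_l (a b : A) m n i j : (i < j <= m)%N ->
  block_weight (pair_chi m n) (pair_args a b m n) (rk_seg (@pair_rk m n) i j)
    = Bcum1 B (j - i) a.
Proof.
move=> ijm; have cV : #|rk_seg (@pair_rk m n) i j| = (j - i)%N.
  by rewrite card_rk_seg; [|exact: pair_rk_bij|lia].
rewrite (@block_weight_const _ _ _ _ Lft a) ?cV //; first by lia.
move=> k; rewrite inE !ffunE pair_rkE; case: ltnP => //; lia.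
Qed.

Lemma pair_weight_r (a b : A) m n i j : (m <= i < j)%N -> (j <= m + n)%N ->
  block_weight (pair_chi m n) (pair_args a b m n) (rk_seg (@pair_rk m n) i j)
    = Bcum1 B (j - i) b.
Proof.
move=> ijm jn; have cV : #|rk_seg (@pair_rk m n) i j| = (j - i)%N.
  by rewrite card_rk_seg //; exact: pair_rk_bij.
rewrite (@block_weight_const _ _ _ _ Rgt b) ?cV //; first by lia.
move=> k; rewrite inE !ffunE pair_rkE; case: ltnP => //; lia.
Qed.

Lemma pair_weight_lr (a b : A) m n i j : (i < m)%N -> (m < j <= m + n)%N ->
  block_weight (pair_chi m n) (pair_args a b m n) (rk_seg (@pair_rk m n) i j)
    = Bcum2 B (m - i) (j - m) a b.
Proof.
move=> im mjn; set V := rk_seg _ i j.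
have cV : #|V| = (m - i + (j - m))%N.
  by rewrite card_rk_seg; [lia|exact: pair_rk_bij|lia].
(* [pair_rk] fixes the positions below m, so this cardinal is the index at which the restricted word
   passes from a to b. *)
have cVm : #|[set x in V | (x < m)%N]| = (m - i)%N.
  rewrite -(card_rk_seg (@pair_rk_bij m n)) ?leq_addr //.
  apply: eq_card => x; rewrite !inE pair_rkE.
  by case: ltnP => /=; lia.
apply: multi_functional_ext => // k l /= kl.
by rewrite !ffunE enum_val_lt cVm kl.
Qed.

(** The last l ranks carry only b, so the tail is compared with the word made of l letters b and no
    a. *)
Lemma pair_tail_sum_r (a b : A) m n l : (l <= n)%N ->
  tail_sum (@pair_rk m n) (block_weight (pair_chi m n) (pair_args a b m n))
    (m + n - l) = phi (b ^+ l).
Proof.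
move=> ln; rewrite -[b ^+ l]mul1r -(expr0 a) phi_pair -[X in _ = tail_sum _ _ X](subnn l).
apply: (tail_sum_eq (n' := 0 + l) (c := l)) => //; try exact: pair_rk_bij.
  by lia.
move=> p q qpl; rewrite !pair_weight_r; try by lia.
by congr Bcum1; lia.
Qed.

Lemma pair_tail_sum (a b : A) m n p : (p <= m)%N ->
  tail_sum (@pair_rk m n) (block_weight (pair_chi m n) (pair_args a b m n))
    (m - p) = phi (a ^+ p * b ^+ n).
Proof.
move=> pm; rewrite phi_pair -[X in _ = tail_sum _ _ X](subnn (p + n)) -(subnDr n m p).
apply: (tail_sum_eq (c := p + n)) => //; try exact: pair_rk_bij.
  by lia.
(* As i and j count from the end, n <= j places the segment among the a, i <= n among the b;
   otherwise it straddles. *)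
move=> i j ijc; have [nj|jn] := leqP n j.
  by rewrite !pair_weight_l; [congr Bcum1| |]; lia.
have [iN|ni] := leqP i n.
  by rewrite !pair_weight_r; [congr Bcum1| | | |]; lia.
by rewrite !pair_weight_lr; [congr Bcum2| | | |]; lia.
Qed.

(** These are the coefficients of h_b = 1 + eta_b h_b; q is the number of letters after the first
    block. *)
Lemma phi_exp_rec (b : A) n : (0 < n)%N ->
  phi (b ^+ n) = \sum_(q < n) Bcum1 B (n - q) b * phi (b ^+ q).
Proof.
move=> n0; rewrite -(pair_tail_sum_r b b 0 (leqnn n)) tail_sum_rev; last by lia.
  apply: eq_bigr => q _; have := ltn_ord q => qn.
  by rewrite pair_weight_r ?pair_tail_sum_r; [congr (Bcum1 _ _ _ * _)| | |]; lia.
exact: pair_rk_bij.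
Qed.

Lemma phi_exp2_rec (a b : A) m n : (0 < m)%N ->
  phi (a ^+ m * b ^+ n) =
    \sum_(q < m) Bcum1 B (m - q) a * phi (a ^+ q * b ^+ n) +
    \sum_(q < n) Bcum2 B m (n - q) a b * phi (b ^+ q).
Proof.
move=> m0; rewrite phi_pair -[X in tail_sum _ _ X = _](subnn (m + n)) tail_sum_rev; last first.
- by lia.
- exact: pair_rk_bij.
rewrite subnn; set S := tail_sum _ _; set w := block_weight _ _; set seg := rk_seg _.
rewrite -(big_mkord xpredT (fun q => w (seg 0%N (m + n - q)%N) * S (m + n - q)%N)).
(* With q letters left after the first block, q < n means that it straddles and n <= q that it
   contains only a; the latter range is shifted by n. *)
rewrite (big_cat_nat (leq0n n) (leq_addl m n)) /= addrC.
rewrite -{1}(add0n n) big_addn addnK !big_mkord.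
congr (_ + _); apply: eq_bigr => q _; have qlt := ltn_ord q.
  rewrite (_ : m + n - (q + n) = m - q)%N; last by lia.
  by rewrite /S /w pair_tail_sum ?pair_weight_l ?subn0 //; lia.
rewrite /S /w pair_tail_sum_r ?pair_weight_lr ?subn0; try by lia.
by congr (Bcum2 _ _ _ _ _ * _); lia.
Qed.

End MomentRecursion.

(** * Coefficients of products in K[[z, w]] *)

Lemma coefs_sum (R : zmodType) (I : Type) (s : seq I) (P : pred I) (F : I -> fps R) k :
  coefs (\sum_(i <- s | P i) F i) k = \sum_(i <- s | P i) coefs (F i) k.
Proof. exact: (big_morph (fun f : fps R => coefs f k)). Qed.

Section BivariateSeries.
Variable R : comNzRingType.
Implicit Types (f : fps R) (g : fps (fps R)).

Lemma fps2P g h : (forall m n, coefs (coefs g n) m = coefs (coefs h n) m) -> g = h.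
Proof. by move=> gh; apply/fpsP => n; apply/fpsP => m. Qed.

(** The outer index is the degree in w, where [in_z f] is constant: only the last term of the outer
    convolution survives. *)
Lemma coefs_mul_in_z g f m n :
  coefs (coefs (g * in_z f) n) m =
    \sum_(i < m.+1) coefs (coefs g n) i * coefs f (m - i).
Proof.
rewrite coefsM coefs_sum big_ord_recr /= big1 ?add0r ?subnn //.
move=> j _; rewrite big1 // => i _.
by rewrite ifN ?mulr0 // subn_eq0 -ltnNge.
Qed.

Lemma coefs_in_w_mul f g m n :
  coefs (coefs (in_w f * g) n) m =
    \sum_(j < n.+1) coefs f j * coefs (coefs g (n - j)) m.
Proof.
rewrite coefsM coefs_sum; apply: eq_bigr => j _ /=.
rewrite big_ord_recl subn0 /= big1 ?addr0 // => i _.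
by rewrite mul0r.
Qed.

(** [in_z fpsX] and [in_w fpsX] are z and w, the factors separating Cauchy series from moment
    series. *)
Definition fpsX : fps R := Fps (fun m => (m == 1%N)%:R).

Lemma coefs_mul_in_z_X g m n :
  coefs (coefs (g * in_z fpsX) n) m = if m is k.+1 then coefs (coefs g n) k else 0.
Proof.
rewrite coefs_mul_in_z; case: m => [|m].
  by rewrite big_ord_recl big_ord0 mulr0 addr0.
rewrite !big_ord_recr /= subnn mulr0 addr0 subSnn mulr1 big1 ?add0r // => i _.
by rewrite subSn 1?ltnW //= eqSS subn_eq0 leqNgt ltn_ord mulr0.
Qed.

Lemma coefs_in_w_X_mul g m n :
  coefs (coefs (in_w fpsX * g) n) m = if n is k.+1 then coefs (coefs g k) m else 0.
Proof.
rewrite coefs_in_w_mul; case: n => [|n].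
  by rewrite big_ord_recl big_ord0 mul0r addr0.
rewrite !big_ord_recl /= mul0r add0r mul1r subSS subn0 big1 ?addr0 // => i _.
by rewrite mul0r.
Qed.

End BivariateSeries.

(** * Series identities and the eta-transform *)

Section EtaTransform.
Variables (K : fieldType) (A : algType K) (phi : {scalar A}).
Variable B : multi_functional A.
Hypotheses (phi1 : phi 1 = 1) (hB : is_Bcumulants phi B).

Lemma Bcum2_r0 (a b : A) m : Bcum2 B m 0 a b = Bcum1 B m a.
Proof.
apply: multi_functional_ext; first exact: addn0.
move=> i j /= ij; rewrite !ffunE.
by have := ltn_ord i; rewrite [X in (_ < X)%N]addn0 => ->.
Qed.

(** All sides are right here, while [Bcum1] uses left ones; [Bcumulants_const] reconciles the
    two. *)
Lemma Bcum2_l0 (a b : A) n : (0 < n)%N -> Bcum2 B 0 n a b = Bcum1 B n b.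
Proof.
by move=> n0; rewrite -(Bcumulants_const hB Rgt).
Qed.

Definition moment_series (a : A) : fps K := Fps (fun m => phi (a ^+ m)).

Definition moment_series2 (a b : A) : fps (fps K) :=
  fps2 (fun m n => phi (a ^+ m * b ^+ n)).

(** This is the series D; the pure powers of z and of w cancel. *)
Definition straddling_series (a b : A) : fps (fps K) :=
  1 + eta2 B a b - in_z (eta1 B a) - in_w (eta1 B b).

Lemma coefs_straddling_series (a b : A) m n :
  coefs (coefs (straddling_series a b) n) m =
    if (m == 0%N) || (n == 0%N) then (m + n == 0)%N%:R else Bcum2 B m n a b.
Proof.
rewrite /straddling_series !coefsD !coefsN coefs1 /=.
case: m n => [|m] [|n] /=; rewrite ?coefs1 ?coefs0 /=.
- by rewrite !subr0 addr0.
- by rewrite Bcum2_l0 // add0r subr0 subrr.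
- by rewrite Bcum2_r0 add0r subr0 subrr.
- by rewrite !subr0 add0r.
Qed.

Lemma moment_series_eta (a : A) :
  in_z (moment_series a) = in_z (moment_series a) * in_z (eta1 B a) + 1.
Proof.
apply: fps2P => m n; rewrite !coefsD coefs_mul_in_z coefs1 /=.
rewrite big_ord_recr /= subnn mulr0 addr0.
case: n => [|n] /=; last by rewrite big1 ?add0r // => i _; rewrite mul0r.
case: m => [|m]; first by rewrite big_ord0 add0r expr0 phi1.
rewrite addr0 (phi_exp_rec phi1 hB) //; apply: eq_bigr => q _.
by rewrite ifN 1?mulrC // subn_eq0 -ltnNge.
Qed.

Lemma moment_series2_eta (a b : A) :
  moment_series2 a b = moment_series2 a b * in_z (eta1 B a)
    + in_w (moment_series b) * straddling_series a b.
Proof.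
apply: fps2P => m n; rewrite !coefsD coefs_mul_in_z coefs_in_w_mul.
under [X in _ + X]eq_bigr do rewrite coefs_straddling_series.
rewrite big_ord_recr /= subnn mulr0 addr0 big_ord_recr /= subnn orbT addn0.
(* For m = 0 the first block cannot start with a; only the constant term 1 of D contributes, leaving
   phi (b ^+ n). *)
case: m => [|m].
  rewrite big_ord0 add0r big1 ?add0r ?mulr1 ?expr0 ?mul1r // => j _.
  by rewrite subn_eq0 leqNgt ltn_ord mulr0.
rewrite mulr0 addr0 (phi_exp2_rec phi1 hB) //.
congr (_ + _); apply: eq_bigr => q _; rewrite mulrC.
  by rewrite ifN // subn_eq0 -ltnNge.
by rewrite subn_eq0 leqNgt ltn_ord.
Qed.

Lemma moment_series2E (a b : A) :
  moment_series2 a b =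
    in_z (moment_series a) * in_w (moment_series b) * straddling_series a b.
Proof.
have e1 := moment_series_eta a; have e2 := moment_series2_eta a b.
set H := moment_series2 a b in e2 *; set h := in_z _ in e1 *.
set e := in_z _ in e1 e2; set D := straddling_series a b in e2 *.
set k := in_w _ in e2 *.
(* The relation for h exhibits 1 - e as its inverse, so H is found without leaving K[[z, w]]. *)
have inv_h : h * (1 - e) = 1 by rewrite mulrBr mulr1 {1}e1 addrAC subrr add0r.
have eD : H * (1 - e) = k * D by rewrite mulrBr mulr1 {1}e2 addrAC subrr add0r.
by rewrite -mulrA -eD mulrCA inv_h mulr1.
Qed.

Lemma in_z_cauchyV (a : A) :
  in_z (cauchyV phi a) = in_z (moment_series a) * in_z (fpsX K).
Proof.
by apply: fps2P => m n; rewrite coefs_mul_in_z_X /=; case: m n => [|m] [|n].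
Qed.

Lemma in_w_cauchyV (b : A) :
  in_w (cauchyV phi b) = in_w (fpsX K) * in_w (moment_series b).
Proof.
by apply: fps2P => m n; rewrite coefs_in_w_X_mul /=; case: m n => [|m] [|n].
Qed.

Lemma cauchy2V_moment (a b : A) :
  cauchy2V phi a b = in_w (fpsX K) * (moment_series2 a b * in_z (fpsX K)).
Proof.
apply: fps2P => m n; rewrite coefs_in_w_X_mul.
by case: n => [|n]; rewrite ?coefs_mul_in_z_X /=; case: m.
Qed.

Lemma cauchy2VE (a b : A) :
  cauchy2V phi a b =
    in_z (cauchyV phi a) * in_w (cauchyV phi b) * straddling_series a b.
Proof.
by rewrite cauchy2V_moment moment_series2E in_z_cauchyV in_w_cauchyV; ring.
Qed.

(** The coefficient of z is phi 1 = 1. *)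
Lemma in_z_cauchyV_neq0 (a : A) : in_z (cauchyV phi a) != 0.
Proof.
apply/eqP => /fpsP /(_ 0%N) /fpsP /(_ 1%N) /= /eqP.
by rewrite expr0 phi1 (negbTE (oner_neq0 K)).
Qed.

Lemma in_w_cauchyV_neq0 (b : A) : in_w (cauchyV phi b) != 0.
Proof.
apply/eqP => /fpsP /(_ 1%N) /fpsP /(_ 0%N) /= /eqP.
by rewrite expr0 phi1 (negbTE (oner_neq0 K)).
Qed.

End EtaTransform.

Unset Implicit Arguments.

Theorem theorem4p3 (R : realType) (A : algType R[i]) (phi : {scalar A})
    (phi1 : phi 1 = 1) (B : multi_functional A) (hB : is_Bcumulants phi B)
    (a b : A) :
  (eta2 B a b)%:F =
    (in_z (eta1 B a))%:F + (in_w (eta1 B b))%:F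
    + (cauchy2V phi a b)%:F
      / ((in_z (cauchyV phi a))%:F * (in_w (cauchyV phi b))%:F)
    - 1 :> {fraction fps (fps R[i])}.
Proof.
(* The factorisation of [cauchy2V] reduces the quotient to D, whose definition is the claim
   rearranged. *)
rewrite (cauchy2VE phi1 hB) !rmorphM /= mulrC mulKf; last first.
  by rewrite mulf_neq0 // tofrac_eq0 ?in_z_cauchyV_neq0 ?in_w_cauchyV_neq0.
rewrite /straddling_series !rmorphB !rmorphD rmorph1 /=; ring.
Qed.
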